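(* Let $d\ge1$, $N\ge0$ be integers, $\kappa\in\mathbb R^{d+1}$ with all $\kappa_i>-1$, and $y=(y',y_{d+1})\in\mathbb R^{d+1}$ with $y'\in\mathbb R^d$ and $|y|=y_1+\cdots+y_{d+1}\neq0$. For $\beta\in\mathbb N_0^{d+1}$ with $|\beta|\le N$, $$|y|^N R_\beta^\kappa\!\left(\frac{y'}{|y|}\right)=\frac{(-1)^{|\beta|}}{(-N)_{|\beta|}}\sum_{\alpha\in\mathbb Z_N^{d+1}}\frac{N!}{\alpha!}\,\mathsf Q_\beta(\alpha;\kappa,N)\,y^\alpha .$$
   Context: Notation: $(a)_n=a(a+1)\cdots(a+n-1)$, $(a)_0=1$; for vectors, $|y|$ is the sum of the components (no absolute values), $\alpha!=\prod_i\alpha_i!$, $y^\alpha=\prod_iy_i^{\alpha_i}$, $(y)_\alpha=\prod_i(y_i)_{\alpha_i}$; $\mathbf 1=(1,\dots,1)$; $\gamma\le\alpha$ is componentwise. $\mathbb Z_N^{d+1}=\{\alpha\in\mathbb N_0^{d+1}:|\alpha|=N\}$. The polynomials $R_\alpha^\kappa$: for $\alpha\in\mathbb N_0^{d+1}$ and $x\in\mathbb R^d$, with $X=(x,1-|x|)$, $R_\alpha^\kappa(x)$ is the orthogonal polynomial of degree $|\alpha|$ with respect to $W_\kappa(x)=x_1^{\kappa_1}\cdots x_d^{\kappa_d}(1-|x|)^{\kappa_{d+1}}$ on the simplex $\{x\in\mathbb R^d:x_i\ge0,|x|\le1\}$ such that $R_\alpha^\kappa(x)-X^\alpha$ is a polynomial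 of degree at most $|\alpha|-1$; explicitly $$R_\alpha^\kappa(x)=\frac{(-1)^{|\alpha|}(\kappa+\mathbf 1)_\alpha}{(|\kappa|+d+|\alpha|)_{|\alpha|}}\sum_{\gamma\le\alpha}\frac{(-\alpha)_\gamma(|\kappa|+d+|\alpha|)_{|\gamma|}}{(\kappa+\mathbf 1)_\gamma\,\gamma!}X^\gamma .$$ Monic Hahn polynomials: let $\langle f,g\rangle_{\mathsf H_{\kappa,N}}=\frac{N!}{(|\kappa|+d+1)_N}\sum_{x\in\mathbb Z_N^{d+1}}f(x)g(x)\frac{(\kappa+\mathbf 1)_x}{x!}$. $\Pi_n^d$ is the space of polynomials of total degree at most $n$ in $x_1,\dots,x_d$ ($\Pi_{-1}^d=\{0\}$), regarded as functions on $\mathbb Z_N^{d+1}$ (where $x_{d+1}=N-x_1-\cdots-x_d$); polynomials in $x_1,\dots,x_{d+1}$ are regarded as functions on $\mathbb Z_N^{d+1}$ in the same way. $\mathcal V_n^d(\mathsf H_{\kappa,N})$ is the space of $p\in\Pi_n^d$ orthogonal to $\Pi_{n-1}^d$. With $\mathrm m_\alpha(x)=(-1)^{|\alpha|}(-x)_\alpha$, for $|\alpha|\le N$, $\mathsf Q_\alpha(\cdot;\kappa,N)$ is the unique element of $\mathcal V_{|\alpha|}^d(\mathsf H_{\kappa,N})$ with $\mathsf Q_\alpha-\mathrm m_\alpha\in\Pi_{|\alpha|-1}^d$. *)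

(* Defs.v *)
From HB Require Import structures.
From mathcomp Require Import all_boot all_order all_algebra.
From mathcomp Require Import boolp classical_sets reals.
From mathcomp Require Import mpoly.

Import Order.TTheory GRing.Theory Num.Theory.

Local Open Scope ring_scope.
Local Open Scope classical_set_scope.

Definition vsum {R : realType} {n : nat} (y : 'I_n -> R) : R := \sum_(i < n) y i.

Definition poch {R : realType} (a : R) (n : nat) : R :=
  \prod_(0 <= i < n) (a + i%:R).

Definition mpoch {R : realType} {n : nat} (y : 'I_n -> R) (a : 'X_{1..n}) : R :=
  \prod_(i < n) poch (y i) (a i).

Definition mfactorial {n : nat} (a : 'X_{1..n}) : nat := (\prod_(i < n) (a i)`!)%N.

Definition mpower {R : realType} {n : nat} (y : 'I_n -> R) (a : 'X_{1..n}) : R :=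
  \prod_(i < n) y i ^+ a i.

(* The first d entries of a vector with d + 1 entries. *)
Definition initv {T : Type} {d : nat} (y : 'I_d.+1 -> T) : 'I_d -> T :=
  fun i => y (lift ord_max i).

(* X = (x, 1 - |x|) *)
Definition simplex_ext {R : realType} {d : nat} (x : 'I_d -> R) : 'I_d.+1 -> R :=
  fun i => if unlift ord_max i is Some j then x j else 1 - vsum x.

(* The monic orthogonal polynomial on the simplex for the weight
   x_1^k_1 ... x_d^k_d (1 - |x|)^k_(d+1), with leading part X^a, given by its
   explicit Lauricella-type expansion. *)
Definition jacobiR {R : realType} {d : nat} (k : 'I_d.+1 -> R) (a : 'X_{1..d.+1})
    (x : 'I_d -> R) : R :=
  let k1 := fun i => k i + 1 in
  let c := vsum k + d%:R + (mdeg a)%:R in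
  (-1) ^+ mdeg a * mpoch k1 a / poch c (mdeg a) *
  \sum_(g : 'X_{1..d.+1 < (mdeg a).+1} | (g <= a)%MM)
    mpoch (fun i => - (a i)%:R) g * poch c (mdeg g) /
    (mpoch k1 g * (mfactorial g)%:R) * mpower (simplex_ext x) g.

(* Z_N^(d+1): multi-indices with d + 1 entries of sum exactly N. *)
Definition grid (d N : nat) : finType :=
  {a : 'X_{1..d.+1 < N.+1} | mdeg a == N}.

Definition mnm_of_grid {d N : nat} (a : grid d N) : 'X_{1..d.+1} := bmnm (val a).

Definition gridfun (R : realType) (d N : nat) := {ffun grid d N -> R}.

Definition gridpt (R : realType) {d N : nat} (a : grid d N) : 'I_d.+1 -> R :=
  fun i => (mnm_of_grid a i)%:R.

Definition hahn_dot {R : realType} {d N : nat} (k : 'I_d.+1 -> R)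
    (f g : gridfun R d N) : R :=
  (N`!)%:R / poch (vsum k + d%:R + 1) N *
  \sum_(x : grid d N) f x * g x *
    (mpoch (fun i => k i + 1) (mnm_of_grid x) / (mfactorial (mnm_of_grid x))%:R).

(* Restrictions to the grid of the polynomials in x_1, ..., x_d of total degree
   strictly less than n (msize is the degree plus one, and 0 for the zero
   polynomial): Pi_m^d is [Pi_lt R d N m.+1], and [Pi_lt R d N 0] = {0}. *)
Definition Pi_lt (R : realType) (d N n : nat) : set (gridfun R d N) :=
  [set f | exists2 p : {mpoly R[d]}, (msize p <= n)%N &
             forall x : grid d N, f x = p.@[initv (gridpt R x)]].

Definition hahnV {R : realType} {d : nat} (N : nat) (k : 'I_d.+1 -> R) (n : nat) :
    set (gridfun R d N) :=
  [set f | Pi_lt R d N n.+1 f /\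
           forall g, Pi_lt R d N n g -> hahn_dot k f g = 0].

Definition hahn_m (R : realType) {d : nat} (N : nat) (b : 'X_{1..d.+1}) : gridfun R d N :=
  [ffun x : grid d N => (-1) ^+ mdeg b * mpoch (fun i => - gridpt R x i) b].

Definition is_hahnQ {R : realType} {d : nat} (N : nat) (k : 'I_d.+1 -> R)
    (b : 'X_{1..d.+1}) (f : gridfun R d N) : Prop :=
  hahnV N k (mdeg b) f /\ Pi_lt R d N (mdeg b) (f - hahn_m R N b).

(* Definite description; the default value 0 is only used if no such function
   exists. *)
Definition hahnQ {R : realType} {d : nat} (N : nat) (k : 'I_d.+1 -> R)
    (b : 'X_{1..d.+1}) : gridfun R d N :=
  xget 0 [set f | is_hahnQ N k b f].

(* Main.v *)
(* Extracting the coefficient of y^x in |y|^N R_b(y'/|y|) with the multinomial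
   theorem reduces the claim to the explicit formula
     Q_b(x) = (-N)_n (k+1)_b / (c)_n *
       sum_(g <= b) (-b)_g (c)_|g| / ((k+1)_g g!) * (-x)_g / (-N)_|g|,
   where n = |b| and c = |k| + d + n.  Its leading part is m_b, and Hahn's inner
   product is definite, so only orthogonality to Pi_(n-1) is at stake.  Test it
   against (k+1+x)_D with |D| = n-1: by Chu-Vandermonde the sum over x cancels the
   factor (c)_|g|, and the sum over g becomes a product of one-variable sums
   sum_j (-b_i)_j / j! (k_i+1+j)_(D_i), one of which vanishes as a finite
   difference of order b_i > D_i.  These test functions suffice because
     sum_i (k+1+x)_(D+e_i) = (|k|+d+1+N+|D|) (k+1+x)_D   on |x| = N,
   with a positive factor, which gives all lower |D|, and
   x_i (k+1+x)_D = (k+1+x)_(D+e_i) - (k_i+1+D_i) (k+1+x)_D. *)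

Require Import Defs.
From HB Require Import structures.
From mathcomp Require Import all_boot all_order all_algebra.
From mathcomp Require Import boolp classical_sets reals.
From mathcomp Require Import mpoly.
From mathcomp Require Import ring lra zify.

Import Order.TTheory GRing.Theory Num.Theory.
Local Open Scope ring_scope.

(** * One-variable Pochhammer symbols and finite differences *)

Lemma natr_fact_neq0 {R : realType} n : (n`!)%:R != 0 :> R.
Proof. by rewrite pnatr_eq0 -lt0n fact_gt0. Qed.

Lemma poch0 {R : realType} (a : R) : poch a 0 = 1.
Proof. by rewrite /poch big_geq. Qed.

Lemma pochSr {R : realType} (a : R) n : poch a n.+1 = poch a n * (a + n%:R).
Proof. by rewrite /poch big_nat_recr. Qed.

Lemma pochS {R : realType} (a : R) n : poch a n.+1 = a * poch (a + 1) n.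
Proof.
rewrite /poch big_nat_recl // addr0; congr (_ * _).
by apply: eq_bigr => i _; rewrite -addrA nat1r.
Qed.

Lemma pochD {R : realType} (a : R) m n :
  poch a (m + n) = poch a m * poch (a + m%:R) n.
Proof.
elim: n => [|n IHn]; first by rewrite addn0 poch0 mulr1.
by rewrite addnS !pochSr IHn natrD addrA mulrA.
Qed.

Lemma poch_gt0 {R : realType} (a : R) n : 0 < a -> 0 < poch a n.
Proof. by move=> a0; apply: prodr_gt0 => i _; rewrite ltr_wpDr. Qed.

(** Up to sign, (-n)_m is the falling factorial n!/(n-m)!; the product form avoids division. *)
Lemma poch_oppn {R : realType} m n : (m <= n)%N ->
  poch (- n%:R : R) m * ((n - m)`!)%:R = (-1) ^+ m * (n`!)%:R.
Proof.
elim: m => [|m IHm] mn; first by rewrite poch0 subn0.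
have E : (n - m)%N = (n - m.+1).+1 by lia.
rewrite exprS -mulrA -IHm 1?ltnW // E factS natrM pochSr.
have -> : (n - m.+1).+1%:R = n%:R - m%:R :> R by rewrite -E natrB 1?ltnW.
ring.
Qed.

Lemma poch_oppn_eq0 {R : realType} m n : (n < m)%N -> poch (- n%:R : R) m = 0.
Proof.
move=> nm; have -> : m = (n.+1 + (m - n.+1))%N by lia.
by rewrite pochD pochSr addNr mulr0 mul0r.
Qed.

Lemma poch_oppn_neq0 {R : realType} m n : (m <= n)%N -> poch (- n%:R : R) m != 0.
Proof.
move=> mn; have /eqP := @poch_oppn R _ _ mn; apply: contraTneq => ->.
by rewrite mul0r eq_sym mulf_neq0 ?signr_eq0 // pnatr_eq0 -lt0n fact_gt0.
Qed.

(** Pascal's rule splits each binomial coefficient: a difference of order b + 1 is one of order b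
    applied to a first difference. *)
Lemma alternating_binomial_sum_rec {R : pzRingType} (f : nat -> R) b :
  \sum_(j < b.+2) (-1) ^+ j * 'C(b.+1, j)%:R * f j =
  \sum_(j < b.+1) (-1) ^+ j * 'C(b, j)%:R * (f j - f j.+1).
Proof.
rewrite big_ord_recl bin0 /=.
under eq_bigr => j _ do
  rewrite /bump /= add1n binS natrD mulrDr mulrDl exprS mulN1r !mulNr.
rewrite big_split /= big_ord_recr /= bin_small // mulr0 mul0r oppr0 addr0.
under [RHS]eq_bigr => j _ do rewrite mulrBr.
rewrite [RHS]big_split /= addrA; congr (_ + _).
rewrite [RHS]big_ord_recl /= bin0; congr (_ + _); apply: eq_bigr => j _.
by rewrite /bump /= add1n exprS !mulN1r !mulNr.
Qed.

(* A finite difference of order b of a polynomial of degree e < b. *)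
Lemma alternating_binomial_sum_poch {R : realType} (a : R) b e : (e < b)%N ->
  \sum_(j < b.+1) (-1) ^+ j * 'C(b, j)%:R * poch (a + j%:R) e = 0.
Proof.
elim: b e a => [//|b IHb] e a eb.
rewrite (alternating_binomial_sum_rec (fun j => poch (a + j%:R) e)).
case: e eb => [|e] eb.
  by rewrite big1 // => j _; rewrite !poch0 subrr mulr0.
(* The first difference of (a+j)_(e+1) in j is -(e+1) (a+1+j)_e, so both orders drop by one and a
   moves to a + 1. *)
rewrite -[RHS](mulr0 (- e.+1%:R)) -[X in _ = _ * X](IHb e (a + 1)) // mulr_sumr.
apply: eq_bigr => j _; rewrite -[j.+1%:R]natr1 pochS !addrA pochSr.
rewrite [a + 1 + _]addrAC -natr1; ring.
Qed.

(** Here (-b)_j / j! = (-1)^j C(b,j), so this is the finite difference above in hypergeometric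
    form. *)
Lemma sum_poch_oppn_eq0 {R : realType} (a : R) b e : (e < b)%N ->
  \sum_(j < b.+1) poch (- b%:R) j / (j`!)%:R * poch (a + j%:R) e = 0.
Proof.
move=> eb; rewrite -[RHS](alternating_binomial_sum_poch a _ _ eb).
apply: eq_bigr => j _; congr (_ * _).
have jb : (j <= b)%N by rewrite -ltnS.
have nz := @natr_fact_neq0 R.
apply: (mulIf (nz (b - j)%N)); rewrite mulrAC poch_oppn //.
rewrite -(bin_fact jb) !natrM; field; exact: nz.
Qed.

(** * Multi-index Pochhammer symbols, factorials and powers *)

Lemma mpochD {R : realType} {n} (a : 'I_n -> R) (g h : 'X_{1..n}) :
  mpoch a (g + h)%MM = mpoch a g * mpoch (fun i => a i + (g i)%:R) h.
Proof. by rewrite -big_split; apply: eq_bigr => i _; rewrite mnmDE pochD. Qed.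

Lemma mpoch0 {R : realType} {n} (a : 'I_n -> R) : mpoch a 0%MM = 1.
Proof. by rewrite /mpoch big1 // => i _; rewrite mnm0E poch0. Qed.

Lemma mpoch1 {R : realType} {n} (a : 'I_n -> R) i : mpoch a U_(i)%MM = a i.
Proof.
rewrite /mpoch (bigD1 i) //= mnm1E eqxx pochS poch0 mulr1 big1 ?mulr1 // => j ji.
by rewrite mnm1E eq_sym (negPf ji) poch0.
Qed.

Lemma mpoch_gt0 {R : realType} {n} (a : 'I_n -> R) g :
  (forall i, 0 < a i) -> 0 < mpoch a g.
Proof. by move=> a0; apply: prodr_gt0 => i _; apply: poch_gt0. Qed.

Lemma mfactorial_gt0 {n} (g : 'X_{1..n}) : (0 < mfactorial g)%N.
Proof. by apply: prodn_gt0 => i; apply: fact_gt0. Qed.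

Lemma mfactorial_neq0 {R : realType} {n} (g : 'X_{1..n}) :
  (mfactorial g)%:R != 0 :> R.
Proof. by rewrite pnatr_eq0 -lt0n mfactorial_gt0. Qed.

Lemma mdegR {R : pzRingType} {n} (g : 'X_{1..n}) : (mdeg g)%:R = \sum_i (g i)%:R :> R.
Proof. by rewrite mdegE natr_sum. Qed.

Lemma signr_mdeg {R : pzRingType} {n} (g : 'X_{1..n}) :
  (-1) ^+ mdeg g = \prod_i (-1) ^+ g i :> R.
Proof. by rewrite mdegE expr_sum. Qed.

Lemma mpoch_oppn_eq0 {R : realType} {n} (g b : 'X_{1..n}) :
  ~~ (g <= b)%MM -> mpoch (fun i => - (b i)%:R : R) g = 0.
Proof.
move=> gb; have [i bg] : exists i, (b i < g i)%N.
  apply/existsP; apply: contraR gb; rewrite negb_exists => /forallP H.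
  by apply/mnm_lepP => i; rewrite leqNgt.
by rewrite /mpoch (bigD1 i) //= poch_oppn_eq0 ?mul0r.
Qed.

(** With x = z + g this reads (-x)_g / x! = (-1)^|g| / (x-g)!, the form in which Pochhammer factors
    are absorbed by a shift of the grid. *)
Lemma mpoch_oppn {R : realType} {n} (z g : 'X_{1..n}) :
  mpoch (fun i => - ((z + g)%MM i)%:R : R) g / (mfactorial (z + g)%MM)%:R =
  (-1) ^+ mdeg g / (mfactorial z)%:R.
Proof.
rewrite signr_mdeg /mfactorial !natr_prod /mpoch -!prodf_div; apply: eq_bigr => i _.
have le : (g i <= (z + g)%MM i)%N by rewrite mnmDE leq_addl.
have := @poch_oppn R _ _ le; rewrite {2}mnmDE addnK.
have nz := @natr_fact_neq0 R.
move=> E; apply/eqP; rewrite eqr_div // E; exact/eqP.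
Qed.

Lemma mpoch_oppn_self {R : realType} {n} (b : 'X_{1..n}) :
  mpoch (fun i => - (b i)%:R : R) b = (-1) ^+ mdeg b * (mfactorial b)%:R.
Proof.
rewrite signr_mdeg /mfactorial natr_prod /mpoch -big_split /=.
by apply: eq_bigr => i _; rewrite -poch_oppn // subnn mulr1.
Qed.

Lemma mpowerD {R : realType} {n} (y : 'I_n -> R) (g h : 'X_{1..n}) :
  mpower y (g + h)%MM = mpower y g * mpower y h.
Proof. by rewrite -big_split; apply: eq_bigr => i _; rewrite mnmDE exprD. Qed.

Lemma mpower1 {R : realType} {n} (y : 'I_n -> R) i : mpower y U_(i)%MM = y i.
Proof.
rewrite /mpower (bigD1 i) //= mnm1E eqxx expr1 big1 ?mulr1 // => j ji.
by rewrite mnm1E eq_sym (negPf ji).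
Qed.

Lemma mpower0 {R : realType} {n} (y : 'I_n -> R) : mpower y 0%MM = 1.
Proof. by rewrite /mpower big1 // => i _; rewrite mnm0E. Qed.

(** * Sums over the grid: shifts, multinomial theorem, Chu-Vandermonde *)

Lemma grid_mdeg {d N} (x : grid d N) : mdeg (mnm_of_grid x) = N.
Proof. exact/eqP/(valP x). Qed.

Lemma grid_exists {d N} (m : 'X_{1..d.+1}) :
  mdeg m = N -> exists x : grid d N, mnm_of_grid x = m.
Proof.
move=> mN; have lt : (mdeg m < N.+1)%N by rewrite mN.
have e : mdeg (BMultinom lt) == N by apply/eqP.
by exists (exist _ (BMultinom lt) e).
Qed.

Lemma mnm_of_grid_inj {d N} : injective (@mnm_of_grid d N).
Proof. by move=> x y /val_inj /val_inj. Qed.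

Lemma sum_grid_shift {V : nmodType} {d N} (g : 'X_{1..d.+1}) (F : 'X_{1..d.+1} -> V) :
  (mdeg g <= N)%N ->
  \sum_(x : grid d N | (g <= mnm_of_grid x)%MM) F (mnm_of_grid x) =
  \sum_(z : grid d (N - mdeg g)) F (mnm_of_grid z + g)%MM.
Proof.
move=> gN.
have up (z : grid d (N - mdeg g)) : {x : grid d N | mnm_of_grid x = (mnm_of_grid z + g)%MM}.
  by apply/cid/grid_exists; rewrite mdegD grid_mdeg subnK.
have bij : {on [pred x : grid d N | (g <= mnm_of_grid x)%MM], bijective (fun z => sval (up z))}.
  have down (x : grid d N) : {z : grid d (N - mdeg g) |
      (g <= mnm_of_grid x)%MM -> (mnm_of_grid z + g)%MM = mnm_of_grid x}.
    have [le|nle] := boolP (g <= mnm_of_grid x)%MM; last first.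
      (* When g is not below x any point serves as default value; the smaller grid has one because
         there is at least one coordinate. *)
      have : exists m : 'X_{1..d.+1}, mdeg m = (N - mdeg g)%N.
        by exists (U_(ord0) *+ (N - mdeg g))%MM; rewrite mdegMn mdeg1 mul1n.
      by case/cid=> m /grid_exists/cid[z _]; exists z.
    have /grid_exists/cid[z ze] : mdeg (mnm_of_grid x - g)%MM = (N - mdeg g)%N.
      by have := grid_mdeg x; rewrite -{1}(submK le) mdegD; lia.
    by exists z; rewrite ze submK.
  exists (fun x => sval (down x)) => [z _|x xg].
    apply: mnm_of_grid_inj; case: (down _) => /= z'; case: (up z) => /= x -> H.
    by apply/(@addIm _ g); rewrite H // lem_addl.
  apply: mnm_of_grid_inj; case: (up _) => /= x' ->; case: (down x) => /= z'.
  by apply.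
rewrite (reindex _ bij) /=; apply: eq_big => [z|z _]; case: (up z) => /= x -> //.
by rewrite lem_addl.
Qed.

(** Points x not above g drop out since (-x)_g vanishes there; on the others x = z + g turns x! into
    z!. *)
Lemma sum_grid_mpoch {R : realType} {d N} (g : 'X_{1..d.+1}) (G : 'X_{1..d.+1} -> R) :
  (mdeg g <= N)%N ->
  \sum_(x : grid d N) mpoch (fun i => - gridpt R x i) g /
     (mfactorial (mnm_of_grid x))%:R * G (mnm_of_grid x) =
  (-1) ^+ mdeg g *
  \sum_(z : grid d (N - mdeg g)) G (mnm_of_grid z + g)%MM / (mfactorial (mnm_of_grid z))%:R.
Proof.
move=> gN; rewrite (bigID (fun x => g <= mnm_of_grid x)%MM) /= addrC big1 => [|x xg]; last first.
  by rewrite mpoch_oppn_eq0 ?mul0r.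
rewrite add0r (sum_grid_shift g
  (fun m => mpoch (fun i => - (m i)%:R) g / (mfactorial m)%:R * G m)) //.
by rewrite mulr_sumr; apply: eq_bigr => z _; rewrite mpoch_oppn; ring.
Qed.

(* Euler's identity for the homogeneous part of degree N of the generating
   function of G; it covers both the multinomial theorem (u constant) and the
   Chu-Vandermonde sum (u affine). *)
Lemma sum_grid_rec {R : realType} {d} N (G : 'X_{1..d.+1} -> R) (u : nat -> R) :
  (forall z, \sum_i G (z + U_(i))%MM = u (mdeg z) * G z) ->
  \sum_(x : grid d N) G (mnm_of_grid x) / (mfactorial (mnm_of_grid x))%:R =
  G 0%MM * (\prod_(0 <= i < N) u i) / (N`!)%:R.
Proof.
move=> Gu; elim: N => [|N IHN].
  have [x0 _] := @grid_exists d 0 0%MM mdeg0.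
  have x0E (x : grid d 0) : mnm_of_grid x = 0%MM by apply/eqP; rewrite -mdeg_eq0 grid_mdeg.
  rewrite (bigD1 x0) //= big1 => [|x]; last first.
    by case/eqP; apply: mnm_of_grid_inj; rewrite !x0E.
  rewrite x0E big_geq // /mfactorial big1 => [|i _]; last by rewrite mnm0E.
  by rewrite fact0 mulr1 addr0.
have nz : N.+1%:R != 0 :> R by rewrite pnatr_eq0.
apply: (mulfI nz); rewrite mulr_sumr.
(* The factor N + 1 = |x| is the sum of the x_i, and x_i = -(-x)_(e_i), so each summand is a shift
   by e_i. *)
transitivity (\sum_(x : grid d N.+1) \sum_i (- mpoch (fun i => - gridpt R x i) U_(i)%MM
     / (mfactorial (mnm_of_grid x))%:R * G (mnm_of_grid x))).
  apply: eq_bigr => x _; rewrite -mulr_suml -mulr_suml.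
  under eq_bigr => i _ do rewrite mpoch1 opprK.
  by rewrite -mdegR grid_mdeg; ring.
rewrite exchange_big /=.
transitivity (\sum_(i < d.+1) \sum_(z : grid d N)
    G (mnm_of_grid z + U_(i))%MM / (mfactorial (mnm_of_grid z))%:R).
  apply: eq_bigr => i _.
  under eq_bigr => x _ do rewrite !mulNr.
  rewrite sumrN sum_grid_mpoch mdeg1 // expr1 mulN1r opprK.
  by rewrite subn1.
rewrite exchange_big /=.
under eq_bigr => z _ do rewrite -mulr_suml Gu grid_mdeg -mulrA.
rewrite -mulr_sumr IHN big_nat_recr //= factS natrM.
by field; rewrite nat1r nz pnatr_eq0 -lt0n fact_gt0.
Qed.

Lemma multinomial_theorem {R : realType} {d} N (y : 'I_d.+1 -> R) :
  \sum_(x : grid d N) mpower y (mnm_of_grid x) / (mfactorial (mnm_of_grid x))%:R =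
  vsum y ^+ N / (N`!)%:R.
Proof.
rewrite (@sum_grid_rec _ _ _ _ (fun=> vsum y)) => [|z].
  by rewrite mpower0 mul1r prodr_const_nat subn0.
rewrite mulrC /vsum mulr_sumr; apply: eq_bigr => i _.
by rewrite mpowerD mpower1.
Qed.

(** The new factors a_i + z_i add up to |a| + |z|. This drives Chu-Vandermonde and later lowers the
    degree of the test functions. *)
Lemma sum_mpochU {R : realType} {n} (a : 'I_n -> R) z :
  \sum_i mpoch a (z + U_(i))%MM = (vsum a + (mdeg z)%:R) * mpoch a z.
Proof.
rewrite mdegR /vsum -big_split mulr_suml; apply: eq_bigr => i _.
by rewrite mpochD mpoch1 mulrC.
Qed.

Lemma chu_vandermonde {R : realType} {d} N (a : 'I_d.+1 -> R) :
  \sum_(x : grid d N) mpoch a (mnm_of_grid x) / (mfactorial (mnm_of_grid x))%:R =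
  poch (vsum a) N / (N`!)%:R.
Proof.
rewrite (@sum_grid_rec _ _ _ _ (fun m => vsum a + m%:R)) => [|z]; last exact: sum_mpochU.
by rewrite mpoch0 mul1r.
Qed.


(** * Sums over the multi-indices below a given one *)

Lemma leq_mnm_mdeg {n} (b : 'X_{1..n}) i : (b i <= mdeg b)%N.
Proof. by rewrite mdegE (bigD1 i) //= leq_addr. Qed.

Lemma lem_mdeg {n} (g b : 'X_{1..n}) : (g <= b)%MM -> (mdeg g <= mdeg b)%N.
Proof. by move=> /submK <-; rewrite mdegD leq_addl. Qed.

Lemma lem_mdeg_eq {n} (g b : 'X_{1..n}) :
  (g <= b)%MM -> mdeg g = mdeg b -> g = b.
Proof.
move=> /submK {1 2}<-; rewrite mdegD => E.
have /eqP : mdeg (b - g)%MM = 0%N by lia.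
by rewrite mdeg_eq0 => /eqP ->; rewrite add0m.
Qed.

(** Distributivity, once the multi-indices below b are matched with functions into the ordinals up
    to |b|. *)
Lemma sum_lem_prod {R : comPzRingType} {n} (b : 'X_{1..n}) (F : 'I_n -> nat -> R) :
  \sum_(g : 'X_{1..n < (mdeg b).+1} | (g <= b)%MM) \prod_i F i (g i) =
  \prod_i \sum_(j < (b i).+1) F i j.
Proof.
under [RHS]eq_bigr => i _ do
  rewrite (big_ord_widen (mdeg b).+1) ?ltnS ?leq_mnm_mdeg //.
rewrite bigA_distr_big_dep /=.
(* The default [bm0] is taken only when the total degree exceeds |b|, which cannot happen for f
   below b. *)
pose mk (f : {ffun 'I_n -> 'I_(mdeg b).+1}) : 'X_{1..n < (mdeg b).+1} :=
  insubd bm0 [multinom (f i : nat) | i < n].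
have mkE f : f \in family (fun i (j : 'I_(mdeg b).+1) => (j < (b i).+1)%N) ->
    (mk f <= b)%MM /\ mk f = [multinom (f i : nat) | i < n] :> 'X_{1..n}.
  move=> /familyP fb.
  have le : ([multinom (f i : nat) | i < n] <= b)%MM.
    by apply/mnm_lepP => i; rewrite mnmE; exact: (fb i).
  have E : mk f = [multinom (f i : nat) | i < n] :> 'X_{1..n}.
    by rewrite /mk val_insubd ltnS lem_mdeg.
  by rewrite E.
rewrite [RHS](reindex_onto (fun g : 'X_{1..n < (mdeg b).+1} =>
    [ffun i => inord (g i)]) mk) => [|f fb]; last first.
  have [_ E] := mkE f fb; apply/ffunP => i; rewrite ffunE; apply: val_inj.
  by rewrite /= E mnmE inordK.
have gE (g : 'X_{1..n < (mdeg b).+1}) i :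
    ([ffun i => inord (g i)] i : 'I_(mdeg b).+1) = g i :> nat.
  by rewrite ffunE inordK // ltnS (leq_trans (leq_mnm_mdeg _ i)) // -ltnS bmdeg.
apply: eq_big => [g|g _]; last by apply: eq_bigr => i _; rewrite gE.
apply/idP/andP => [gb|[fb /eqP <-]]; last by have [] := mkE _ fb.
have fam : [ffun i => inord (g i)] \in
    family (fun i (j : 'I_(mdeg b).+1) => (j < (b i).+1)%N).
  by apply/familyP => i; rewrite unfold_in gE ltnS; exact: (mnm_lepP gb i).
split=> //; have [_ E] := mkE _ fam; apply/eqP/val_inj; rewrite /= E.
by apply/mnmP => i; rewrite mnmE gE.
Qed.

(** * Polynomial functions on the grid *)

Section Pi.
Variables (R : realType) (d N : nat).

Lemma Pi_ltB n f g : Pi_lt R d N n f -> Pi_lt R d N n g -> Pi_lt R d N n (f - g).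
Proof.
move=> [p pn fp] [q qn gq]; exists (p - q).
  by rewrite (leq_trans (msizeD_le _ _)) // geq_max msizeN pn.
by move=> x; rewrite !ffunE fp gq mevalB.
Qed.

Lemma Pi_lt_sum n (I : finType) (P : pred I) (a : I -> R) (f : I -> gridfun R d N) :
  (forall i, P i -> Pi_lt R d N n (f i)) ->
  Pi_lt R d N n [ffun x => \sum_(i | P i) a i * f i x].
Proof.
move=> H.
(* Representing polynomials are chosen for all i at once; outside [P] the choice is 0. *)
have /choice[p pP] (i : I) : exists p : {mpoly R[d]}, P i ->
    (msize p <= n)%N /\ forall x, f i x = p.@[initv (gridpt R x)].
  by have [/H[p pn fp]|_] := boolP (P i); [exists p|exists 0].
exists (\sum_(i | P i) a i *: p i).
  rewrite (leq_trans (msize_sum _ _ _)) //; apply/bigmax_leqP => i /pP[pn _].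
  exact: leq_trans (msizeZ_le _ _) pn.
move=> x; rewrite ffunE raddf_sum; apply: eq_bigr => i /pP[_ ->].
by rewrite /= mevalZ.
Qed.

Lemma Pi_lt_le m n f : (m <= n)%N -> Pi_lt R d N m f -> Pi_lt R d N n f.
Proof. by move=> mn [p pm fp]; exists p => //; apply: leq_trans mn. Qed.

(** Since [msize] is the degree plus one, the successors make these plain degree bounds, valid for
    the zero polynomial too. *)
Lemma msizeM_leS (p q : {mpoly R[d]}) m n : (msize p <= m.+1)%N ->
  (msize q <= n.+1)%N -> (msize (p * q) <= (m + n).+1)%N.
Proof.
have [->|p0] := eqVneq p 0; first by rewrite mul0r msize0.
have [->|q0] := eqVneq q 0; first by rewrite mulr0 msize0.
by rewrite msizeM //; move: (mmeasure _ p) (mmeasure _ q) => a b; lia.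
Qed.

Lemma Pi_lt_hahn_m (b : 'X_{1..d.+1}) : Pi_lt R d N (mdeg b).+1 (hahn_m R N b).
Proof.
(* On the grid the last coordinate is N minus the others, so every coordinate has degree at most 1
   in the first d variables. *)
pose X (i : 'I_d.+1) : {mpoly R[d]} :=
  if unlift ord_max i is Some j then 'X_j else N%:R%:MP - \sum_j 'X_j.
have sX i : (msize (X i) <= 2)%N.
  rewrite /X; case: (unlift _ _) => [j|]; first by rewrite msizeX mdeg1.
  rewrite (leq_trans (msizeD_le _ _)) // geq_max msizeN msizeC.
  rewrite (leq_trans (leq_b1 _)) //=.
  by rewrite (leq_trans (msize_sum _ _ _)) //; apply/bigmax_leqP => j _; rewrite msizeX mdeg1.
have eX i (x : grid d N) : (X i).@[initv (gridpt R x)] = gridpt R x i.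
  rewrite /X; case: unliftP => [j ->|->]; first by rewrite mevalXU.
  have E : N%:R = \sum_i gridpt R x i by rewrite -mdegR grid_mdeg.
  rewrite mevalB mevalC E big_ord_recr /=.
  apply: (canLR (addrK _)); rewrite addrC; congr (_ + _).
  rewrite (raddf_sum (meval _)); apply: eq_bigr => j _; rewrite /= mevalXU.
  by rewrite /initv /gridpt; congr (mnm_of_grid x _)%:R; apply: val_inj; rewrite [RHS]lift_max.
exists ((-1) ^+ mdeg b *: \prod_i \prod_(0 <= j < b i) (- X i + j%:R%:MP)).
  rewrite (leq_trans (msizeZ_le _ _)) // mdegE.
  apply: (big_ind2 (fun (p : {mpoly R[d]}) n => msize p <= n.+1)%N) => [|*|i _].
  - by rewrite msize1.
  - exact: msizeM_leS.
  have bi : b i = (\sum_(0 <= j < b i) 1)%N by rewrite sum_nat_const_nat subn0 muln1.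
  rewrite [X in (_ <= X.+1)%N]bi.
  elim/big_ind2: _ => [|*|j _]; [by rewrite msize1|exact: msizeM_leS|].
  rewrite (leq_trans (msizeD_le _ _)) // geq_max msizeN sX msizeC.
  by rewrite (leq_trans (leq_b1 _)).
move=> x; rewrite ffunE mevalZ; congr (_ * _).
rewrite rmorph_prod; apply: eq_bigr => i _; rewrite rmorph_prod.
by apply: eq_bigr => j _; rewrite /= mevalD mevalN mevalC eX.
Qed.

Lemma mevalE_mpower (p : {mpoly R[d]}) (v : 'I_d -> R) :
  p.@[v] = \sum_(m <- msupp p) p@_m * mpower v m.
Proof. exact: mevalE. Qed.

(** Test functions of top degree n - 1 suffice: they yield those of lower degree, then these times
    monomials, hence all polynomials. *)
Lemma Pi_lt_annihilator (k : 'I_d.+1 -> R) (h : grid d N -> R) n :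
  0 < vsum k + d%:R + 1 ->
  (forall D : 'X_{1..d.+1}, (mdeg D).+1 = n ->
    \sum_x h x * mpoch (fun i => k i + 1 + gridpt R x i) D = 0) ->
  forall g, Pi_lt R d N n g -> \sum_x h x * g x = 0.
Proof.
move=> s0 h0.
pose P (x : grid d N) := mpoch (fun i => k i + 1 + gridpt R x i).
(* Induction on e = n - 1 - |D|: summing the vanishing relations for D + e_i gives a positive
   multiple of the one for D. *)
have {}h0 e D : (mdeg D + e.+1)%N = n -> \sum_x h x * P x D = 0.
  elim: e D => [|e IHe] D De; first by apply: h0; rewrite -De addn1.
  have nz : vsum k + d%:R + 1 + (N + mdeg D)%:R != 0 by rewrite gt_eqF // ltr_wpDr.
  apply: (mulfI nz); rewrite mulr0 mulr_sumr.
  transitivity (\sum_x \sum_i h x * P x (D + U_(i))%MM); last first.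
    rewrite exchange_big big1 //= => i _; apply: IHe.
    by rewrite mdegD mdeg1 -addnA.
  apply: eq_bigr => x _; rewrite -mulr_sumr sum_mpochU mulrCA; congr (_ * (_ * _)).
  rewrite /vsum !big_split /= sumr_const card_ord -mdegR grid_mdeg natrD.
  by rewrite -[d.+1%:R]natr1; ring.
(* D stays free in the induction on m, since removing a variable from mu may raise D by a unit
   vector. *)
have h0' m mu D : mdeg mu = m -> (m + mdeg D < n)%N ->
    \sum_x h x * (mpower (initv (gridpt R x)) mu * P x D) = 0.
  elim: m mu D => [|m IHm] mu D.
    move/eqP; rewrite mdeg_eq0 => /eqP -> Dn.
    under eq_bigr do rewrite mpower0 mul1r.
    by apply: (h0 (n - (mdeg D).+1)%N); lia.
  move=> mum Dn.
  have [i mui] : exists i, (U_(i) <= mu)%MM.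
    apply/existsP; apply/contraT; rewrite negb_exists => /forallP H.
    move: mum; rewrite mdegE big1 // => i _; have := H i.
    by rewrite lep1mP negbK => /eqP.
  have {}mum : mdeg (mu - U_(i))%MM = m.
    by move: mum; rewrite -{1}(submK mui) mdegD mdeg1; lia.
  pose j := lift ord_max i.
  (* The removed x_i is written as (k_j+1+D_j+x_j) - (k_j+1+D_j), where j is i seen among all d + 1
     coordinates. *)
  transitivity (\sum_x h x * (mpower (initv (gridpt R x)) (mu - U_(i))%MM * P x (D + U_(j))%MM)
    - (k j + 1 + (D j)%:R) * \sum_x h x * (mpower (initv (gridpt R x)) (mu - U_(i))%MM * P x D)).
    rewrite mulr_sumr -sumrB; apply: eq_bigr => x _.
    rewrite -{1}(submK mui) mpowerD mpower1 /P mpochD mpoch1 /initv -/j; ring.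
  rewrite !IHm ?mulr0 ?subr0 // ?mdegD ?mdeg1; lia.
move=> g [p pn gp].
under eq_bigr => x _ do rewrite gp mevalE_mpower mulr_sumr.
rewrite exchange_big big_seq big1 //= => m mp.
under eq_bigr => x _ do rewrite mulrCA -[mpower _ _]mulr1
  -(mpoch0 (fun i => k i + 1 + gridpt R x i)).
rewrite -mulr_sumr (h0' (mdeg m)) ?mulr0 // mdeg0 addn0.
exact: leq_trans (msize_mdeg_lt mp) pn.
Qed.

End Pi.


(** * The explicit Hahn polynomial and its characterization *)

(** The sign (-1)^|g| in the last factor cancels the one inside [hahn_m], leaving (-x)_g /
    (-N)_|g|. *)
Definition hahn_coef {R : realType} {d : nat} (N : nat) (k : 'I_d.+1 -> R)
    (b g : 'X_{1..d.+1}) : R :=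
  let k1 := fun i => k i + 1 in
  let c := vsum k + d%:R + (mdeg b)%:R in
  poch (- N%:R) (mdeg b) * mpoch k1 b / poch c (mdeg b) *
  (mpoch (fun i => - (b i)%:R) g * poch c (mdeg g) /
     (mpoch k1 g * (mfactorial g)%:R)) *
  ((-1) ^+ mdeg g / poch (- N%:R) (mdeg g)).

Definition hahn_explicit {R : realType} {d : nat} (N : nat) (k : 'I_d.+1 -> R)
    (b : 'X_{1..d.+1}) : gridfun R d N :=
  [ffun x => \sum_(g : 'X_{1..d.+1 < (mdeg b).+1} | (g <= b)%MM)
     hahn_coef N k b g * hahn_m R N g x].

Definition hahn_weight {R : realType} {d N : nat} (k : 'I_d.+1 -> R) (x : grid d N) : R :=
  mpoch (fun i => k i + 1) (mnm_of_grid x) / (mfactorial (mnm_of_grid x))%:R.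

Section Hahn.
Variables (R : realType) (d N : nat) (k : 'I_d.+1 -> R).
Hypothesis k_gt : forall i, -1 < k i.

Lemma k1_gt0 i : 0 < k i + 1.
Proof. by have := k_gt i; lra. Qed.

Lemma hahn_weight_gt0 (x : grid d N) : 0 < hahn_weight k x.
Proof.
by rewrite divr_gt0 ?ltr0n ?mfactorial_gt0 // mpoch_gt0 // => i; apply: k1_gt0.
Qed.

Lemma vsum_gt : 0 < vsum k + d%:R + 1.
Proof.
have -> : vsum k + d%:R + 1 = \sum_i (k i + 1).
  by rewrite big_split /= sumr_const card_ord -natr1 addrA.
rewrite big_ord_recl ltr_pwDl ?sumr_ge0 //; first by have := k_gt ord0; lra.
by move=> i _; have := k_gt (lift ord0 i); lra.
Qed.

Lemma poch_c_gt0 n m : (0 < n)%N -> 0 < poch (vsum k + d%:R + n%:R) m.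
Proof.
case: n => // n _; apply: poch_gt0; rewrite -nat1r addrA ltr_wpDr //.
exact: vsum_gt.
Qed.

(** For n = 0 the base |k| + d may be zero or negative, but then the product is empty. *)
Lemma poch_c_neq0 n : poch (vsum k + d%:R + n%:R) n != 0.
Proof. by case: n => [|n]; [rewrite poch0 oner_eq0|rewrite gt_eqF ?poch_c_gt0]. Qed.

Lemma hahn_coef_self b : (mdeg b <= N)%N -> hahn_coef N k b b = 1.
Proof.
move=> bN; rewrite /hahn_coef mpoch_oppn_self.
have s2 : (-1) ^+ mdeg b * (-1) ^+ mdeg b = 1 :> R by rewrite -expr2 sqrr_sign.
have h1 := @poch_oppn_neq0 R _ _ bN; have h2 := poch_c_neq0 (mdeg b).
have h3 : mpoch (fun i => k i + 1) b != 0 by rewrite gt_eqF ?mpoch_gt0 // => i; apply: k1_gt0.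
have h4 := @mfactorial_neq0 R _ b.
rewrite -[RHS]s2; field; exact/and4P.
Qed.

Lemma hahn_explicit_Pi b : Pi_lt R d N (mdeg b).+1 (hahn_explicit N k b).
Proof.
apply: Pi_lt_sum => g gb; apply: Pi_lt_le (Pi_lt_hahn_m _ _ _ g).
by rewrite ltnS lem_mdeg.
Qed.

(** The term g = b is exactly [hahn_m] at b, and any other g below b has strictly smaller degree. *)
Lemma hahn_explicit_lead b : (mdeg b <= N)%N ->
  Pi_lt R d N (mdeg b) (hahn_explicit N k b - hahn_m R N b).
Proof.
move=> bN; pose b' := BMultinom (ltnSn (mdeg b)).
have -> : hahn_explicit N k b - hahn_m R N b =
    [ffun x => \sum_(g : 'X_{1..d.+1 < (mdeg b).+1} | (g <= b)%MM && (g != b'))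
       hahn_coef N k b g * hahn_m R N g x].
  apply/ffunP => x; rewrite !ffunE (bigD1 b') ?lepm_refl //=.
  by rewrite hahn_coef_self // mul1r !ffunE addrAC subrr add0r.
apply: Pi_lt_sum => g /andP[gb gb']; apply: Pi_lt_le (Pi_lt_hahn_m _ _ _ g).
rewrite ltn_neqAle lem_mdeg // andbT; apply: contra gb' => /eqP E.
by apply/eqP/val_inj => /=; apply: lem_mdeg_eq.
Qed.

(* With |D| = |b| - 1 the parameter |k1| + |D| of the Chu-Vandermonde sum equals
   the parameter c of Q_b, so the remaining sum over g factors. *)
Lemma hahn_explicit_orth b (D : 'X_{1..d.+1}) : (mdeg b <= N)%N ->
  (mdeg D).+1 = mdeg b ->
  \sum_(x : grid d N) hahn_explicit N k b x * hahn_weight k x *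
     mpoch (fun i => k i + 1 + gridpt R x i) D = 0.
Proof.
move=> bN Db; set c := vsum k + d%:R + (mdeg b)%:R.
have Db' : (mdeg D)%:R + 1 = (mdeg b)%:R :> R by rewrite natr1 Db.
pose k1 i := k i + 1.
under eq_bigr => x _ do rewrite ffunE !mulr_suml.
rewrite exchange_big /=.
(* [K] collects what no longer depends on g once the sum over x is evaluated. *)
pose K := poch (- N%:R) (mdeg b) * mpoch k1 b / poch c (mdeg b) * poch c N / (N`!)%:R.
transitivity (\sum_(g : 'X_{1..d.+1 < (mdeg b).+1} | (g <= b)%MM)
    K * \prod_i (poch (- (b i)%:R) (g i) / ((g i)`!)%:R * poch (k1 i + (g i)%:R) (D i))).
  apply: eq_bigr => g gb; have gN := leq_trans (lem_mdeg _ _ gb) bN.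
  transitivity (hahn_coef N k b g * ((-1) ^+ mdeg g *
     \sum_(x : grid d N) mpoch (fun i => - gridpt R x i) g /
     (mfactorial (mnm_of_grid x))%:R * mpoch k1 (mnm_of_grid x + D)%MM)).
    rewrite !mulr_sumr; apply: eq_bigr => x _.
    by rewrite ffunE /hahn_weight mpochD /gridpt /k1; ring.
  rewrite (sum_grid_mpoch g (fun m => mpoch k1 (m + D)%MM)) // mulrA -expr2 sqrr_sign mul1r.
  (* Splitting (k1)_(z+g+D) as (k1)_(g+D) (k1+g+D)_z leaves a Chu-Vandermonde sum of total parameter
     c + |g|. *)
  under [X in _ * X = _]eq_bigr => z _ do rewrite -addmA addmC mpochD -mulrA.
  rewrite -mulr_sumr chu_vandermonde.
  have -> : vsum (fun i => k1 i + ((g + D)%MM i)%:R) = c + (mdeg g)%:R.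
    rewrite /c /vsum !big_split /= sumr_const card_ord -mdegR mdegD natrD.
    by rewrite -Db' -[d.+1%:R]natr1; ring.
  rewrite mpochD !big_split /= -/(mpoch _ D) -/(mpoch _ g) prodfV -natr_prod -/(mfactorial g).
  rewrite -/(mpoch (fun i => k1 i + (g i)%:R) D) /K.
  rewrite /hahn_coef -/c -/k1.
  (* This is where (c)_|g| from the coefficient completes the Chu-Vandermonde value to (c)_N, free
     of g. *)
  have -> : poch c N = poch c (mdeg g) * poch (c + (mdeg g)%:R) (N - mdeg g).
    by rewrite -pochD subnKC.
  have h1 := @poch_oppn_neq0 R _ _ gN; have h2 : poch c (mdeg b) != 0 by apply: poch_c_neq0.
  have h3 : mpoch k1 g != 0 by rewrite gt_eqF ?mpoch_gt0 // => i; apply: k1_gt0.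
  have h4 := @mfactorial_neq0 R _ g.
  have nz := @natr_fact_neq0 R.
  have <- : (-1) ^+ mdeg g / poch (- N%:R) (mdeg g) / ((N - mdeg g)`!)%:R = ((N`!)%:R)^-1 :> R.
    rewrite -mulrA -invfM poch_oppn // invfM mulrA divff ?signr_eq0 ?mul1r //.
  by field; rewrite h1 h2 h3 h4 nz.
rewrite -mulr_sumr (sum_lem_prod b (fun i j =>
  poch (- (b i)%:R) j / (j`!)%:R * poch (k1 i + j%:R) (D i))).
(* As |D| < |b|, some D_i < b_i, and the i-th one-variable sum vanishes. *)
have [i Dbi] : exists i, (D i < b i)%N.
  apply/existsP; apply: contra_eqT Db; rewrite negb_exists => /forallP H.
  rewrite gtn_eqF // ltnS lem_mdeg //; apply/mnm_lepP => i.
  by rewrite leqNgt.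
by rewrite (bigD1 i) //= sum_poch_oppn_eq0 // mul0r mulr0.
Qed.

Lemma hahn_dotE (f g : gridfun R d N) : hahn_dot k f g =
  (N`!)%:R / poch (vsum k + d%:R + 1) N * \sum_x f x * g x * hahn_weight k x.
Proof. by []. Qed.

Lemma hahn_explicitP b : (mdeg b <= N)%N -> is_hahnQ N k b (hahn_explicit N k b).
Proof.
move=> bN; split; last exact: hahn_explicit_lead.
split=> [|g Pg]; first exact: hahn_explicit_Pi.
rewrite hahn_dotE; under eq_bigr => x _ do rewrite mulrAC.
rewrite (@Pi_lt_annihilator _ _ _ k (fun x => _) (mdeg b)) ?mulr0 //; first exact: vsum_gt.
by move=> D; apply: hahn_explicit_orth.
Qed.

(** The leading parts cancel, so f - g lies in the space to which f and g are both orthogonal; it is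
    orthogonal to itself, and the weights are positive. *)
Lemma hahnQ_unique b f g : is_hahnQ N k b f -> is_hahnQ N k b g -> f = g.
Proof.
move=> [[_ of_] lf] [[_ og] lg].
have Pfg : Pi_lt R d N (mdeg b) (f - g).
  have -> : f - g = (f - hahn_m R N b) - (g - hahn_m R N b).
    by rewrite opprB addrA subrK.
  exact: Pi_ltB.
have : \sum_x (f x - g x) ^+ 2 * hahn_weight k x = 0.
  have nz : (N`!)%:R / poch (vsum k + d%:R + 1) N != 0.
    rewrite mulf_neq0 ?invr_eq0 ?pnatr_eq0 -?lt0n ?fact_gt0 //.
    by rewrite gt_eqF // poch_gt0 // vsum_gt.
  have := congr2 (fun u v => u - v) (of_ _ Pfg) (og _ Pfg).
  rewrite subr0 !hahn_dotE -mulrBr -sumrB => /eqP; rewrite mulf_eq0 (negPf nz) /= => /eqP E.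
  by rewrite -[RHS]E; apply: eq_bigr => x _; rewrite !ffunE; ring.
move=> /psumr_eq0P E; apply/ffunP => x; apply/eqP; rewrite -subr_eq0 -sqrf_eq0.
have /eqP := E (fun x _ => mulr_ge0 (sqr_ge0 _) (ltW (hahn_weight_gt0 x))) x isT.
by rewrite mulf_eq0 (gt_eqF (hahn_weight_gt0 x)) orbF.
Qed.

Lemma hahnQE b : (mdeg b <= N)%N -> hahnQ N k b = hahn_explicit N k b.
Proof.
move=> bN; apply: xget_unique; first exact: hahn_explicitP.
by move=> f Hf; apply: hahnQ_unique Hf (hahn_explicitP _ bN).
Qed.
End Hahn.

(** * Homogenization and comparison of coefficients *)

Lemma simplex_ext_homogeneous {R : realType} {d} (y : 'I_d.+1 -> R) i : vsum y != 0 ->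
  simplex_ext (fun i => initv y i / vsum y) i = y i / vsum y.
Proof.
move=> y0; rewrite /simplex_ext; case: unliftP => [j ->|->] //.
apply: (mulIf y0); rewrite divfK // mulrBl mul1r /vsum -mulr_suml divfK //.
rewrite [X in X - _]big_ord_recr /=; apply: (canLR (addrK _)).
rewrite addrC; congr (_ + _); apply: eq_bigr => j _; congr y.
by apply: val_inj; rewrite [RHS]lift_max.
Qed.

(** The left side is y^g |y|^(N-|g|); the multinomial theorem expands the second factor, and
    shifting by g produces (-x)_g. *)
Lemma homogenized_mpower {R : realType} {d} N (y : 'I_d.+1 -> R) (g : 'X_{1..d.+1}) :
  vsum y != 0 -> (mdeg g <= N)%N ->
  vsum y ^+ N * mpower (simplex_ext (fun i => initv y i / vsum y)) g =
  \sum_(x : grid d N) (N`!)%:R / (mfactorial (mnm_of_grid x))%:R *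
    (hahn_m R N g x * ((-1) ^+ mdeg g / poch (- N%:R) (mdeg g))) * mpower y (mnm_of_grid x).
Proof.
move=> y0 gN.
transitivity ((N`!)%:R / poch (- N%:R) (mdeg g) *
  \sum_(x : grid d N) mpoch (fun i => - gridpt R x i) g /
     (mfactorial (mnm_of_grid x))%:R * mpower y (mnm_of_grid x)); last first.
  rewrite mulr_sumr; apply: eq_bigr => x _; rewrite ffunE.
  have s2 : (-1) ^+ mdeg g * (-1) ^+ mdeg g = 1 :> R by rewrite -expr2 sqrr_sign.
  by rewrite -[LHS]mul1r -{1}s2; ring.
rewrite (sum_grid_mpoch g (mpower y)) //.
under eq_bigr => z _ do rewrite mpowerD mulrAC.
rewrite -mulr_suml multinomial_theorem.
have -> : mpower (simplex_ext (fun i => initv y i / vsum y)) g = mpower y g / vsum y ^+ mdeg g.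
  rewrite /mpower mdegE expr_sum -prodf_div; apply: eq_bigr => i _.
  by rewrite simplex_ext_homogeneous // expr_div_n.
rewrite -{1}(subnK gN) exprD.
have nz := @natr_fact_neq0 R (N - mdeg g).
have -> : (N`!)%:R = (-1) ^+ mdeg g * (poch (- N%:R) (mdeg g) * ((N - mdeg g)`!)%:R) :> R.
  by rewrite poch_oppn // mulrA -expr2 sqrr_sign mul1r.
have s2 : (-1) ^+ mdeg g * (-1) ^+ mdeg g = 1 :> R by rewrite -expr2 sqrr_sign.
have h1 := @poch_oppn_neq0 R _ _ gN.
have y0' : vsum y ^+ mdeg g != 0 by rewrite expf_neq0.
rewrite -[LHS]mul1r -{1}s2; by field; rewrite y0' h1 nz.
Qed.

Theorem theorem3p4 (R : realType) (d N : nat) (hd : (1 <= d)%N)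
    (kappa : 'I_d.+1 -> R) (hkappa : forall i, -1 < kappa i)
    (y : 'I_d.+1 -> R) (hy : vsum y != 0)
    (beta : 'X_{1..d.+1}) (hbeta : (mdeg beta <= N)%N) :
  vsum y ^+ N * jacobiR kappa beta (fun i => initv y i / vsum y) =
  (-1) ^+ mdeg beta / poch (- N%:R) (mdeg beta) *
  \sum_(alpha : grid d N)
    (N`!)%:R / (mfactorial (mnm_of_grid alpha))%:R *
    hahnQ N kappa beta alpha * mpower y (mnm_of_grid alpha).
Proof.
rewrite hahnQE // /jacobiR.
rewrite mulrCA mulr_sumr.
under [in RHS]eq_bigr => x _ do rewrite ffunE mulr_sumr mulr_suml.
(* With g outermost on both sides, the identity is checked for each g separately, by homogenizing
   X^g. *)
rewrite exchange_big /= !mulr_sumr; apply: eq_bigr => g gb.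
rewrite (mulrCA (vsum y ^+ N)) homogenized_mpower //; last exact: leq_trans (lem_mdeg _ _ gb) hbeta.
rewrite !mulr_sumr; apply: eq_bigr => x _; rewrite /hahn_coef.
have h1 := @poch_oppn_neq0 R _ _ hbeta.
(* The prefactor 1/(-N)_|b| cancels the normalization (-N)_|b| of the explicit formula. *)
rewrite -[LHS]mul1r -{1}(mulVf h1); ring.
Qed.
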